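(* Suppose the regularity conditions (R), the terminal conditions (T), the simplifying conditions (E) and incremental exponential stability (IES) stated in the context hold, and let the horizon $M\in\mathbb{I}_{\ge1}$ satisfy $C\rho^M<1$. Let $c_{\delta,1},\dots,c_{\delta,4}>0$ be constants for which the inequalities (I) in the context hold (such constants exist under these hypotheses). Then for the closed-loop system $x(k+1)=f(x(k),u(k))+w(k)$, $u(k)=\pi_{\mathrm{impl}}(x(k))$, $x(0)=x_0$: (i) for any $\lambda>0$, the closed-loop system is ISS; (ii) there exist constants $c_{\mathbb{X},1},c_{\mathbb{X},2},c_{\mathbb{X},3}\ge0$ such that for any $x_0\in\mathbb{R}^n$, $\lambda>0$, any disturbances $w(k)\in\mathbb{R}^n$, $k\in\mathbb{I}_{\ge0}$, and any $T\in\mathbb{I}_{\ge0}$, $$\sum_{k=0}^{T-1}\|x(k)\|_{\mathbb{X}}^2\le c_{\mathbb{X},1}\|x_0\|_{\mathbb{X}_N}^2+\frac{c_{\mathbb{X},2}}{\lambda}+c_{\mathbb{X},3}\sum_{k=0}^{T-1}\|w(k)\|^2;$$ (iii) for any $x_0\in\mathbb{X}_N$, $\lambda>0$, any disturbances $w(k)\in\mathbb{R}^n$, $k\in\mathbb{I}_{\ge0}$, and any $T\in\mathbb{I}_{\ge0}$, $$\frac{1}{1+\epsilon_\lambda}\sum_{k=0}^{T-1}\ell(x(k),u(k))\le V_{\mathrm{nom}}(x_0)+\lambda c_{\delta,4}\sum_{k=0}^{T-1}\|w(k)\|^2,\qquad\epsilon_\lambda:=\frac1\lambda\frac{\sigm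a_{\max}(Q)}{c_{\delta,3}}.$$
   Context: Notation. $\|\cdot\|$ is the Euclidean norm; for a positive definite matrix $Q$, $\|x\|_Q=\sqrt{x^\top Qx}$, and $\sigma_{\max}(Q)$ is its maximal eigenvalue; for a set $\mathcal{A}\subset\mathbb{R}^n$, $\|x\|_{\mathcal{A}}=\inf_{s\in\mathcal{A}}\|x-s\|$. $\mathbb{I}_{[a,b]}$ (resp. $\mathbb{I}_{\ge a}$) is the set of integers in $[a,b]$ (resp. $\ge a$). $\mathcal{K}$: continuous strictly increasing functions $\alpha:\mathbb{R}_{\ge0}\to\mathbb{R}_{\ge0}$ with $\alpha(0)=0$; $\mathcal{K}_\infty$: radially unbounded functions in $\mathcal{K}$; $\mathcal{KL}$: functions $\beta:\mathbb{R}_{\ge0}\times\mathbb{I}_{\ge0}\to\mathbb{R}_{\ge0}$ with $\beta(\cdot,k)\in\mathcal{K}$ and $\beta(r,\cdot)$ decreasing with limit $0$. System. $x(k+1)=f(x(k),u(k))+w(k)$, $x(0)=x_0\in\mathbb{R}^n$, with inputs $u(k)\in\mathbb{U}\subseteq\mathbb{R}^m$ and arbitrary disturbances $w(k)\in\mathbb{R}^n$. $\ell:\mathbb{R}^n\times\mathbb{U}\to\mathbb{R}_{\ge0}$ is a stage cost and $\mathbb{X}\subseteq\mathbb{R}^n$ is a closed state constraint set. (R) Regularity: there is $\alpha_\ell\in\mathcal{K}_\infty$ with $\ell(x,u)\ge\alpha_\ell(\|x\|+\|u\|)$ for all $(x,u)\in\mathbb{R}^n\times\mathbb{U}$; $f(0,0)=0$,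 $\ell(0,0)=0$, $0\in\mathrm{int}(\mathbb{U})$, $0\in\mathrm{int}(\mathbb{X})$; $f,\ell$ are continuous; $\mathbb{U}$ is compact. Nominal MPC. Fix $N\in\mathbb{I}_{\ge1}$. For $x\in\mathbb{R}^n$ and an input sequence $\mathbf{u}=(\mathbf{u}_0,\mathbf{u}_1,\dots)$ in $\mathbb{U}$ (finite or infinite), $x_{\mathbf{u}}(k,x)$ is the state after $k$ steps of the undisturbed system ($w\equiv0$) started at $x_{\mathbf{u}}(0,x)=x$. Let $V_{\mathrm{f}}:\mathbb{R}^n\to\mathbb{R}_{\ge0}$ be continuous, $\mathbb{X}_{\mathrm{f}}\subseteq\mathbb{X}$ closed, and $$\mathcal{J}_N(x,\mathbf{u})=\sum_{k=0}^{N-1}\ell(x_{\mathbf{u}}(k,x),\mathbf{u}_k)+V_{\mathrm{f}}(x_{\mathbf{u}}(N,x)).$$ $V_{\mathrm{nom}}(x)$ is the minimum of $\mathcal{J}_N(x,\mathbf{u})$ over $\mathbf{u}\in\mathbb{U}^N$ subject to $x_{\mathbf{u}}(k,x)\in\mathbb{X}$, $k\in\mathbb{I}_{[0,N-1]}$, and $x_{\mathbf{u}}(N,x)\in\mathbb{X}_{\mathrm{f}}$; $\mathbb{X}_N\subseteq\mathbb{X}$ is the set of $x$ for which these constraints are feasible. (T) Terminal conditions: there are $k_{\mathrm{f}}:\mathbb{X}_{\mathrm{f}}\to\mathbb{U}$ and $\alpha_{\mathrm{f}}\in\mathcal{K}_\infty$ such that for every $x\in\mathbb{X}_{\mathrm{f}}$,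 with $u=k_{\mathrm{f}}(x)$, $x^+=f(x,u)$: $V_{\mathrm{f}}(x^+)\le V_{\mathrm{f}}(x)-\ell(x,u)$; $(x,u)\in\mathbb{X}\times\mathbb{U}$; $x^+\in\mathbb{X}_{\mathrm{f}}$; $V_{\mathrm{f}}(x)\le\alpha_{\mathrm{f}}(\|x\|)$. Moreover $0\in\mathrm{int}(\mathbb{X}_{\mathrm{f}})$ and $\mathbb{X}_N$ is compact. (E) Simplifying conditions: $\alpha_\ell(r)=c_\ell r^2$ and $\alpha_{\mathrm{f}}(r)=c_{\mathrm{f}}r^2$ are quadratic; $\ell(x,u)=\|x\|_Q^2+\|u\|_R^2$ with positive definite matrices $Q,R$. (IES) Incremental exponential stability: there are $C\ge1$, $\rho\in[0,1)$ such that for all $x,\bar{x}\in\mathbb{R}^n$, all infinite sequences $\mathbf{u}$ in $\mathbb{U}$, and all $k\in\mathbb{I}_{\ge0}$: $\|x_{\mathbf{u}}(k,x)-x_{\mathbf{u}}(k,\bar{x})\|^2\le C\rho^k\|x-\bar{x}\|^2$. Implicit penalty. $V_{\delta,\mathrm{impl}}(x,\bar{x},\mathbf{u})=\sum_{k=0}^{M-1}\|x_{\mathbf{u}}(k,x)-x_{\mathbf{u}}(k,\bar{x})\|^2$ for $\mathbf{u}\in\mathbb{U}^M$. With $\mathbf{u}_{[k_1,k_2]}$ the subsequence from index $k_1$ to $k_2$, inequalities (I) are: for all $x,\bar{x},w\in\mathbb{R}^n$, $\mathbf{u}\in\mathbb{U}^{M+1}$, $$c_{\delta,1}\|x-\bar{x}\|^2\le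 V_{\delta,\mathrm{impl}}(x,\bar{x},\mathbf{u}_{[0,M-1]})\le c_{\delta,2}\|x-\bar{x}\|^2,$$ $$V_{\delta,\mathrm{impl}}(f(x,\mathbf{u}_0)+w,f(\bar{x},\mathbf{u}_0),\mathbf{u}_{[1,M]})\le V_{\delta,\mathrm{impl}}(x,\bar{x},\mathbf{u}_{[0,M-1]})-c_{\delta,3}\|x-\bar{x}\|^2+c_{\delta,4}\|w\|^2.$$ Implicit relaxed MPC. For $\lambda>0$, $V_{\mathrm{impl}}(x)$ is the minimum over $\bar{x}\in\mathbb{R}^n$, $\mathbf{u}\in\mathbb{U}^N$ of $$\mathcal{J}_N(\bar{x},\mathbf{u})+\lambda\sum_{k=0}^{M-1}\|x_{\mathbf{u}}(k,x)-x_{\mathbf{u}}(k,\bar{x})\|^2$$ subject to $x_{\mathbf{u}}(k,\bar{x})\in\mathbb{X}$ for $k\in\mathbb{I}_{[0,N-1]}$ and $x_{\mathbf{u}}(N,\bar{x})\in\mathbb{X}_{\mathrm{f}}$, where, if $M>N+1$, the sequence $\mathbf{u}$ is extended by $\mathbf{u}_k=k_{\mathrm{f}}(x_{\mathbf{u}}(k,\bar{x}))$ for $k\in\mathbb{I}_{[N,M-2]}$ (the same extended inputs are used in both trajectories). Minimizers are presupposed to exist and are denoted $\bar{x}^*_{\mathrm{impl}}(x),\mathbf{u}^*_{\mathrm{impl}}(x)$; $\pi_{\mathrm{impl}}(x)=\mathbf{u}^*_{\mathrm{impl},0}(x)$. ISS. A system $x(k+1)=f_{\mathrm{cl}}(x(k),w(k))$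 is ISS if there are $\beta\in\mathcal{KL}$, $\gamma\in\mathcal{K}$ such that for every $x(0)\in\mathbb{R}^n$, every sequence $w(k)\in\mathbb{R}^n$, and every $k\in\mathbb{I}_{\ge0}$: $\|x(k)\|\le\beta(\|x(0)\|,k)+\gamma\big(\max_{j\in\mathbb{I}_{[0,k-1]}}\|w(j)\|\big)$ (for $k=0$ the last term is $0$). *)

(* Defs.v *)
From HB Require Import structures.
From mathcomp Require Export all_boot all_order all_algebra.
From mathcomp Require Export all_classical all_reals all_analysis.

Set Implicit Arguments.
Unset Strict Implicit.
Unset Printing Implicit Defensive.

Export Order.TTheory GRing.Theory Num.Theory.
Export numFieldNormedType.Exports.

Local Open Scope classical_set_scope.
Local Open Scope ring_scope.

(* The library norm `|x| on 'cV[R]_n is the max norm.  It induces the same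
   topology as enorm, so continuity, closedness, compactness and interiors are
   the library's. *)
Definition enorm (R : realType) (n : nat) (x : 'cV[R]_n) : R :=
  Num.sqrt (\sum_(i < n) x i 0 ^+ 2).

Definition qform (R : realType) (n : nat) (Q : 'M[R]_n) (x : 'cV[R]_n) : R :=
  (x^T *m Q *m x) 0 0.

Definition posdef (R : realType) (n : nat) (Q : 'M[R]_n) : Prop :=
  Q^T = Q /\ forall x : 'cV[R]_n, x != 0 -> 0 < qform Q x.

Definition wnorm (R : realType) (n : nat) (Q : 'M[R]_n) (x : 'cV[R]_n) : R :=
  Num.sqrt (qform Q x).

Definition sigma_max (R : realType) (n : nat) (Q : 'M[R]_n) : R :=
  sup [set a : R | eigenvalue Q a].

Definition dist_set (R : realType) (n : nat) (A : set 'cV[R]_n)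
    (x : 'cV[R]_n) : R :=
  inf [set enorm (x - s) | s in A].

(* Comparison functions are total functions on R of which only the values at
   nonnegative arguments matter. *)
Definition class_K (R : realType) (a : R -> R) : Prop :=
  [/\ {within [set r : R | 0 <= r], continuous a},
      (forall r s, 0 <= r -> r < s -> a r < a s) & a 0 = 0].

Definition class_Kinf (R : realType) (a : R -> R) : Prop :=
  class_K a /\ a r @[r --> +oo] --> +oo.

Definition class_KL (R : realType) (b : R -> nat -> R) : Prop :=
  (forall k, class_K (b^~ k)) /\
  (forall r, 0 <= r ->
     nonincreasing_seq (b r) /\ (b r k @[k --> \oo] --> (0 : R))).

(* For k = 0 the empty maximum is 0 and gamma 0 = 0. *)
Definition ISS (R : realType) (n : nat)
    (fcl : 'cV[R]_n -> 'cV[R]_n -> 'cV[R]_n) : Prop :=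
  exists (beta : R -> nat -> R) (gamma : R -> R),
    [/\ class_KL beta, class_K gamma &
      forall x w : nat -> 'cV[R]_n,
        (forall k, x k.+1 = fcl (x k) (w k)) ->
        forall k : nat,
          enorm (x k) <= beta (enorm (x 0%N)) k
                         + gamma (\big[Num.max/0]_(j < k) enorm (w j))].

(* Finite input sequences of length L are represented by functions on nat of
   which only the values at indices k < L are constrained and used. *)
Definition inputs_in (R : realType) (m : nat) (U : set 'cV[R]_m) (L : nat)
    (u : nat -> 'cV[R]_m) : Prop :=
  forall k, (k < L)%N -> U (u k).

Fixpoint traj (R : realType) (n m : nat)
    (f : 'cV[R]_n -> 'cV[R]_m -> 'cV[R]_n)
    (u : nat -> 'cV[R]_m) (x : 'cV[R]_n) (k : nat) : 'cV[R]_n :=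
  if k is k'.+1 then f (traj f u x k') (u k') else x.

Definition mpc_cost (R : realType) (n m N : nat)
    (f : 'cV[R]_n -> 'cV[R]_m -> 'cV[R]_n) (l : 'cV[R]_n -> 'cV[R]_m -> R)
    (Vf : 'cV[R]_n -> R) (x : 'cV[R]_n) (u : nat -> 'cV[R]_m) : R :=
  \sum_(k < N) l (traj f u x k) (u k) + Vf (traj f u x N).

Definition mpc_feasible (R : realType) (n m N : nat)
    (f : 'cV[R]_n -> 'cV[R]_m -> 'cV[R]_n)
    (U : set 'cV[R]_m) (X Xf : set 'cV[R]_n)
    (x : 'cV[R]_n) (u : nat -> 'cV[R]_m) : Prop :=
  [/\ inputs_in U N u, (forall k, (k < N)%N -> X (traj f u x k))
    & Xf (traj f u x N)].

Definition feasible_set (R : realType) (n m N : nat)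
    (f : 'cV[R]_n -> 'cV[R]_m -> 'cV[R]_n)
    (U : set 'cV[R]_m) (X Xf : set 'cV[R]_n) : set 'cV[R]_n :=
  [set x | exists u, mpc_feasible N f U X Xf x u].

(* For feasible x the infimum is a minimum when U is compact, X and Xf are
   closed and f, l, Vf are continuous. *)
Definition V_nom (R : realType) (n m N : nat)
    (f : 'cV[R]_n -> 'cV[R]_m -> 'cV[R]_n) (l : 'cV[R]_n -> 'cV[R]_m -> R)
    (Vf : 'cV[R]_n -> R) (U : set 'cV[R]_m) (X Xf : set 'cV[R]_n)
    (x : 'cV[R]_n) : R :=
  inf [set mpc_cost N f l Vf x u | u in mpc_feasible N f U X Xf x].

Definition V_delta_impl (R : realType) (n m M : nat)
    (f : 'cV[R]_n -> 'cV[R]_m -> 'cV[R]_n)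
    (x xb : 'cV[R]_n) (u : nat -> 'cV[R]_m) : R :=
  \sum_(k < M) enorm (traj f u x k - traj f u xb k) ^+ 2.

(* The inputs u_0, ..., u_(N-1) followed by the terminal controller along the
   trajectory started at xb; see ext_inputE. *)
Definition ext_input (R : realType) (n m N : nat)
    (f : 'cV[R]_n -> 'cV[R]_m -> 'cV[R]_n) (kf : 'cV[R]_n -> 'cV[R]_m)
    (xb : 'cV[R]_n) (u : nat -> 'cV[R]_m) (k : nat) : 'cV[R]_m :=
  if (k < N)%N then u k
  else kf (iter (k - N) (fun z => f z (kf z)) (traj f u xb N)).

Lemma ext_inputE (R : realType) (n m N : nat)
    (f : 'cV[R]_n -> 'cV[R]_m -> 'cV[R]_n) (kf : 'cV[R]_n -> 'cV[R]_m)
    (xb : 'cV[R]_n) (u : nat -> 'cV[R]_m) (k : nat) :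
  ext_input N f kf xb u k =
  if (k < N)%N then u k else kf (traj f (ext_input N f kf xb u) xb k).
Proof.
have trajE i : (i <= N)%N ->
    traj f (ext_input N f kf xb u) xb i = traj f u xb i.
  by elim: i => //= i IHi ltiN; rewrite IHi 1?ltnW // /ext_input ltiN.
have trajD i : traj f (ext_input N f kf xb u) xb (N + i) =
    iter i (fun z => f z (kf z)) (traj f u xb N).
  elim: i => [|i IHi]; first by rewrite addn0 trajE.
  by rewrite addnS /= IHi /ext_input ltnNge leq_addr /= addKn.
rewrite {1}/ext_input; case: ltnP => // leNk.
by rewrite -{2}(subnKC leNk) trajD.
Qed.

Definition impl_cost (R : realType) (n m N M : nat)
    (f : 'cV[R]_n -> 'cV[R]_m -> 'cV[R]_n) (l : 'cV[R]_n -> 'cV[R]_m -> R)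
    (Vf : 'cV[R]_n -> R) (kf : 'cV[R]_n -> 'cV[R]_m) (lam : R)
    (x xb : 'cV[R]_n) (u : nat -> 'cV[R]_m) : R :=
  mpc_cost N f l Vf xb u + lam * V_delta_impl M f x xb (ext_input N f kf xb u).

Definition impl_minimizer (R : realType) (n m N M : nat)
    (f : 'cV[R]_n -> 'cV[R]_m -> 'cV[R]_n) (l : 'cV[R]_n -> 'cV[R]_m -> R)
    (Vf : 'cV[R]_n -> R) (kf : 'cV[R]_n -> 'cV[R]_m)
    (U : set 'cV[R]_m) (X Xf : set 'cV[R]_n) (lam : R)
    (x xb : 'cV[R]_n) (u : nat -> 'cV[R]_m) : Prop :=
  mpc_feasible N f U X Xf xb u /\
  forall xb' u', mpc_feasible N f U X Xf xb' u' ->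
    impl_cost N M f l Vf kf lam x xb u <= impl_cost N M f l Vf kf lam x xb' u'.

(* f and l are only constrained on R^n x U. *)
Record regularity (R : realType) (n m : nat)
    (f : 'cV[R]_n -> 'cV[R]_m -> 'cV[R]_n) (l : 'cV[R]_n -> 'cV[R]_m -> R)
    (U : set 'cV[R]_m) (X : set 'cV[R]_n) (alphal : R -> R) : Prop :=
  Regularity {
    reg_alphal : class_Kinf alphal;
    reg_lower : forall x u, U u -> alphal (enorm x + enorm u) <= l x u;
    reg_f0 : f 0 0 = 0;
    reg_l0 : l 0 0 = 0;
    reg_U0 : U° 0;
    reg_X0 : X° 0;
    reg_f : {within [set p : 'cV[R]_n * 'cV[R]_m | U p.2],
              continuous (fun p => f p.1 p.2)};
    reg_l : {within [set p : 'cV[R]_n * 'cV[R]_m | U p.2],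
              continuous (fun p => l p.1 p.2)};
    reg_U : compact U }.

Record terminal_conditions (R : realType) (n m N : nat)
    (f : 'cV[R]_n -> 'cV[R]_m -> 'cV[R]_n) (l : 'cV[R]_n -> 'cV[R]_m -> R)
    (Vf : 'cV[R]_n -> R) (U : set 'cV[R]_m) (X Xf : set 'cV[R]_n)
    (kf : 'cV[R]_n -> 'cV[R]_m) (alphaf : R -> R) : Prop :=
  TerminalConditions {
    term_alphaf : class_Kinf alphaf;
    term_decrease : forall x, Xf x -> Vf (f x (kf x)) <= Vf x - l x (kf x);
    term_constr : forall x, Xf x -> X x /\ U (kf x);
    term_inv : forall x, Xf x -> Xf (f x (kf x));
    term_upper : forall x, Xf x -> Vf x <= alphaf (enorm x);
    term_Xf0 : Xf° 0;
    term_XN : compact (feasible_set N f U X Xf) }.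

Record simplifying_conditions (R : realType) (n m : nat)
    (l : 'cV[R]_n -> 'cV[R]_m -> R) (U : set 'cV[R]_m)
    (alphal alphaf : R -> R) (cl cf : R) (Q : 'M[R]_n) (Ru : 'M[R]_m) : Prop :=
  SimplifyingConditions {
    simp_alphal : forall r, 0 <= r -> alphal r = cl * r ^+ 2;
    simp_alphaf : forall r, 0 <= r -> alphaf r = cf * r ^+ 2;
    simp_Q : posdef Q;
    simp_Ru : posdef Ru;
    simp_l : forall x u, U u -> l x u = wnorm Q x ^+ 2 + wnorm Ru u ^+ 2 }.

Definition incr_exp_stable (R : realType) (n m : nat)
    (f : 'cV[R]_n -> 'cV[R]_m -> 'cV[R]_n) (U : set 'cV[R]_m) (C rho : R) : Prop :=
  forall (x xb : 'cV[R]_n) (u : nat -> 'cV[R]_m), (forall k, U (u k)) ->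
    forall k : nat, enorm (traj f u x k - traj f u xb k) ^+ 2
                    <= C * rho ^+ k * enorm (x - xb) ^+ 2.

Definition impl_inequalities (R : realType) (n m M : nat)
    (f : 'cV[R]_n -> 'cV[R]_m -> 'cV[R]_n) (U : set 'cV[R]_m)
    (c1 c2 c3 c4 : R) : Prop :=
  forall (x xb w : 'cV[R]_n) (u : nat -> 'cV[R]_m), inputs_in U M.+1 u ->
    [/\ c1 * enorm (x - xb) ^+ 2 <= V_delta_impl M f x xb u,
        V_delta_impl M f x xb u <= c2 * enorm (x - xb) ^+ 2 &
        V_delta_impl M f (f x (u 0%N) + w) (f xb (u 0%N)) (fun k => u k.+1)
        <= V_delta_impl M f x xb u
           - c3 * enorm (x - xb) ^+ 2 + c4 * enorm w ^+ 2].

(* Main.v *)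
From mathcomp Require Import ring lra.
Require Import Defs.

Set Implicit Arguments.
Unset Strict Implicit.
Unset Printing Implicit Defensive.

Local Open Scope classical_set_scope.
Local Open Scope ring_scope.

(** The optimal value [V x] of the relaxed problem plays the role of a Lyapunov
function.  Applying the first optimal input and extending the plan by one step
of the terminal controller yields an admissible plan from the successor of the
relaxed initial state [xb].  Because both trajectories inside the penalty receive
the same inputs, the penalty is an incremental Lyapunov function along this
shift, so the single inequality
<<
V (x+) <= V x - (l xb u + lam c3 |x - xb|^2) + lam c4 |w|^2
>>
holds on the whole state space ([impl_value_step]).  Any feasible pair bounds
the value from above ([impl_value_upper]), and each of the three claims comes
from its own choice of that pair.

- Input-to-state stability: the pair at the origin has cost zero, so
  [V x <= lam c2 |x|^2] globally, while the summands [l xb u] and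
  [|x - xb|^2] together dominate a multiple of [|x|^2].  Thus [V] is a quadratic
  Lyapunov function and [ISS_quadratic_lyapunov] applies.
- Constraint violation: [xb] satisfies the state constraint, so the violation at
  [x] is at most [|x - xb|], whose squares are summed by the dissipation
  inequality.  Comparing with a plan started at any point [s] of the compact
  feasible set gives [V x0 <= B + lam c2 |x0 - s|^2], where [B] is uniform
  because the states reachable in finitely many steps form a compact set
  ([mpc_cost_bounded]).  Division by [lam c3] makes the constants independent
  of [lam], up to the summand [B / (c3 lam)].
- Performance: from a feasible [x0] the choice [xb = x0] has zero penalty, so
  [V x0] is at most the nominal value.  Young's inequality compares the stage
  cost at [x] with the one at [xb] ([qform_relaxation]); its constant is the
  largest eigenvalue of [Q], which has to be identified with the maximum of the
  quadratic form on the unit sphere ([qform_le_sigma_max]).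

Constants as required of the penalty exist because the contraction over [M] steps
is strict, [C rho^M < 1]: dropping the first summand of the penalty outweighs the
summand that enters at the end of the window ([exists_impl_inequalities]). *)

(** * Quadratic forms *)

Section QuadraticForms.
Variables (R : realType) (n : nat).
Implicit Types (x y : 'cV[R]_n) (Q : 'M[R]_n).

Lemma enorm_ge0 x : 0 <= enorm x.
Proof. exact: sqrtr_ge0. Qed.

Lemma enorm_sqrE x : enorm x ^+ 2 = \sum_(i < n) x i 0 ^+ 2.
Proof. by rewrite sqr_sqrtr ?sumr_ge0// => i _; exact: sqr_ge0. Qed.

Lemma qform1 x : qform 1%:M x = enorm x ^+ 2.
Proof.
rewrite /qform mulmx1 mxE enorm_sqrE.
by apply: eq_bigr => i _; rewrite mxE expr2.
Qed.

Lemma enorm0 : enorm (0 : 'cV[R]_n) = 0.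
Proof. by rewrite /enorm big1 ?sqrtr0// => i _; rewrite mxE expr0n. Qed.

Lemma enorm_eq0 x : (enorm x == 0) = (x == 0).
Proof.
apply/idP/eqP => [|->]; last by rewrite enorm0.
rewrite -sqrf_eq0 enorm_sqrE psumr_eq0; last by move=> i _; exact: sqr_ge0.
move=> /allP x0; apply/matrixP => i j; rewrite ord1 mxE.
by apply/eqP; rewrite -sqrf_eq0; apply: (x0 i); rewrite mem_index_enum.
Qed.

Lemma enorm_sqr_gt0 x : x != 0 -> 0 < enorm x ^+ 2.
Proof. by rewrite -enorm_eq0 => x0; rewrite exprn_even_gt0//= x0. Qed.

Lemma qformDZ Q (a b : R) x y :
  qform Q (a *: x + b *: y) =
    a ^+ 2 * qform Q x
    + a * b * ((x^T *m Q *m y) 0 0 + (y^T *m Q *m x) 0 0)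
    + b ^+ 2 * qform Q y.
Proof.
rewrite /qform [(_ + _)^T]linearD/= !linearZ/= !mulmxDl !mulmxDr -!scalemxAl -!scalemxAr.
by rewrite !mxE; ring.
Qed.

(** Expanding [0 <= |e x - y|^2] bounds the cross term of [|x + y|^2] by
    [e |x|^2 + |y|^2 / e]. *)
Lemma qform_young Q (e : R) x y : (forall z, 0 <= qform Q z) -> 0 < e ->
  qform Q (x + y) <= (1 + e) * qform Q x + (1 + e^-1) * qform Q y.
Proof.
move=> Q0 e0.
have := Q0 (e *: x + (-1) *: y); rewrite qformDZ.
have := qformDZ Q 1 1 x y; rewrite !scale1r => -> {Q0}.
move: (qform Q x) (qform Q y) ((_ *m y) 0 0 + _) => qx qy s.
move=> h; have : e * s <= e * (e * qx + e^-1 * qy).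
  by rewrite mulrDr mulVKf ?gt_eqF//; lra.
by rewrite ler_pM2l//; lra.
Qed.

Lemma enorm_young (e : R) x y : 0 < e ->
  enorm (x + y) ^+ 2 <= (1 + e) * enorm x ^+ 2 + (1 + e^-1) * enorm y ^+ 2.
Proof.
by move=> e0; rewrite -!qform1 qform_young// => z; rewrite qform1 sqr_ge0.
Qed.

Lemma qform_ge0 Q x : posdef Q -> 0 <= qform Q x.
Proof.
move=> [_ Q0]; have [->|/Q0/ltW//] := eqVneq x 0.
by rewrite /qform mulmx0 mxE.
Qed.

Lemma wnorm_sqrE Q x : posdef Q -> wnorm Q x ^+ 2 = qform Q x.
Proof. by move=> pQ; rewrite sqr_sqrtr// qform_ge0. Qed.

End QuadraticForms.

(** * The largest eigenvalue *)

Section Rayleigh.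
Variables (R : realType) (n : nat).
Implicit Types (x y : 'cV[R]_n) (Q : 'M[R]_n).

Lemma continuous_qform_tr Q : continuous (fun v : 'rV[R]_n => qform Q v^T).
Proof.
have cs (I : finType) (F : I -> 'rV[R]_n -> R) :
    (forall i, continuous (F i)) -> continuous (fun v => \sum_i F i v).
  by move=> cF; apply: continuous_big => //; exact: add_continuous.
have -> : (fun v : 'rV[R]_n => qform Q v^T) =
    (fun v => \sum_j (\sum_i v 0 i * Q i j) * v 0 j).
  apply/funext => v; rewrite /qform trmxK mxE.
  by apply: eq_bigr => j _; rewrite !mxE.
apply: (cs) => j v; apply: continuousM; last exact: coord_continuous.
apply: cs => i {}v; apply: continuousM; first exact: coord_continuous.
exact: cst_continuous.
Qed.

Lemma compact_unit_sphere : compact [set v : 'rV[R]_n | enorm v^T ^+ 2 = 1].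
Proof.
apply: bounded_closed_compact.
  exists 1; split => //= M M1 v /= v1; apply: ltW; apply: le_lt_trans M1.
  rewrite [leLHS]/Num.norm /= mx_normrE; apply/bigmax_leP; split=> //= -[i j] _/=.
  rewrite ord1 -(ler_pXn2r (isT : (0 < 2)%N)) ?nnegrE// expr1n -v1 enorm_sqrE.
  rewrite real_normK ?num_real// (bigD1 j)//= mxE lerDl sumr_ge0// => k _.
  exact: sqr_ge0.
have -> : [set v : 'rV[R]_n | enorm v^T ^+ 2 = 1]
    = (fun v : 'rV[R]_n => qform 1%:M v^T) @^-1` [set 1].
  by apply/seteqP; split => v /=; rewrite qform1.
apply: preimage_closed; last exact: closed_eq.
by move=> v _; exact: continuous_qform_tr.
Qed.

(** The test point [t = - a / (b + 1)] makes the linear term dominate. *)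
Lemma linear_coef_eq0 (a b : R) : 0 <= b ->
  (forall t, 0 <= 2 * t * a + t ^+ 2 * b) -> a = 0.
Proof.
move=> b0 /(_ (- a / (b + 1))).
have -> : 2 * (- a / (b + 1)) * a + (- a / (b + 1)) ^+ 2 * b
   = - (a ^+ 2 * ((b + 2) / (b + 1) ^+ 2)) by field; lra.
rewrite oppr_ge0 pmulr_lle0; last by rewrite divr_gt0 ?exprn_gt0//; lra.
by move=> a0; apply/eqP; rewrite -sqrf_eq0 eq_le a0 sqr_ge0.
Qed.

(** Moving from [x] by [t (Q x)] changes the form by [2 t |Q x|^2] to first order
    in [t], which nonnegativity only permits if [Q x = 0]. *)
Lemma psd_kernel Q x : Q^T = Q -> (forall z, 0 <= qform Q z) ->
  qform Q x = 0 -> Q *m x = 0.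
Proof.
move=> sQ Q0 x0; set y := Q *m x.
have ey : (y^T *m Q *m x) 0 0 = enorm y ^+ 2.
  by rewrite -qform1 /qform mulmx1 -mulmxA.
have ex : (x^T *m Q *m y) 0 0 = enorm y ^+ 2.
  by rewrite -qform1 /qform mulmx1 {2}/y trmx_mul sQ.
have h (t : R) : 0 <= 2 * t * enorm y ^+ 2 + t ^+ 2 * qform Q y.
  have := Q0 (1 *: x + t *: y); rewrite qformDZ x0 ex ey.
  by move=> /le_trans; apply; lra.
apply/eqP; rewrite -enorm_eq0 -sqrf_eq0.
by rewrite (linear_coef_eq0 (Q0 y) h).
Qed.

(** The maximum of the form over the unit sphere is an eigenvalue, because
    [mu |x|^2 - x^T Q x] is then a nonnegative form vanishing at a maximiser. *)
Lemma max_eigenvalue Q : Q^T = Q -> (0 < n)%N ->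
  exists2 mu : R, eigenvalue Q mu &
    forall x, qform Q x <= mu * enorm x ^+ 2.
Proof.
move=> sQ n0; have sph0 : [set v : 'rV[R]_n | enorm v^T ^+ 2 = 1] !=set0.
  exists (delta_mx 0 (Ordinal n0)) => /=.
  rewrite enorm_sqrE (bigD1 (Ordinal n0))//= big1 ?addr0.
    by rewrite !mxE !eqxx expr1n.
  by move=> i /negPf i0; rewrite !mxE i0 andbF expr0n.
have [v] := compact_EVT_max sph0 compact_unit_sphere
  (continuous_subspaceT (@continuous_qform_tr Q)).
rewrite inE/= => v1 vmax; set mu := qform Q v^T in vmax.
have Z (a : R) x : qform Q (a *: x) = a ^+ 2 * qform Q x.
  by have := qformDZ Q a 0 x 0; rewrite !scale0r addr0 => ->; ring.
have le_mu x : qform Q x <= mu * enorm x ^+ 2.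
  have [->|/[dup] x0 /enorm_sqr_gt0 x_gt0] := eqVneq x 0.
    by rewrite enorm0 expr0n mulr0 /qform mulmx0 mxE.
  have /vmax : ((enorm x)^-1 *: x)^T
      \in [set v : 'rV[R]_n | enorm v^T ^+ 2 = 1].
    rewrite inE/= trmxK -qform1.
    have := qformDZ 1%:M (enorm x)^-1 0 x 0.
    rewrite !scale0r addr0 => ->.
    rewrite qform1 mulr0 !mul0r expr0n mul0r !addr0 -exprMn.
    by rewrite mulVf ?expr1n ?enorm_eq0.
  by rewrite trmxK Z exprVn ler_pdivrMl// mulrC.
exists mu => //; apply/eigenvalueP; exists v; last first.
  apply/eqP => v0; move/eqP: v1.
  by rewrite v0 trmx0 enorm0 expr0n eq_sym oner_eq0.
have E z : qform (mu%:M - Q) z = mu * enorm z ^+ 2 - qform Q z.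
  rewrite -qform1 /qform mulmx1 mulmxBr mulmxBl mul_mx_scalar -scalemxAl.
  by rewrite !mxE.
have /eqP : (mu%:M - Q) *m v^T = 0.
  apply: psd_kernel.
  - by rewrite linearB/= tr_scalar_mx sQ.
  - by move=> z; rewrite E subr_ge0.
  - by rewrite E v1 mulr1 subrr.
rewrite mulmxBl mul_scalar_mx subr_eq0 => /eqP /(congr1 trmx).
by rewrite trmx_mul linearZ/= trmxK sQ => <-.
Qed.

Lemma eigenvalue_le Q (mu a : R) : (forall x, qform Q x <= mu * enorm x ^+ 2) ->
  eigenvalue Q a -> a <= mu.
Proof.
move=> le_mu /eigenvalueP[v va v0].
have v_gt0 : 0 < enorm v^T ^+ 2.
  apply: enorm_sqr_gt0; apply: contra v0 => /eqP/(congr1 trmx).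
  by rewrite trmxK trmx0 => ->.
have := le_mu v^T.
have -> : qform Q v^T = a * enorm v^T ^+ 2.
  by rewrite -qform1 /qform mulmx1 trmxK va -scalemxAl mxE.
by rewrite ler_pM2r.
Qed.

Lemma qform_le_sigma_max Q x : Q^T = Q ->
  qform Q x <= sigma_max Q * enorm x ^+ 2.
Proof.
move=> sQ; have [n0|n0] := posnP n.
  have -> : x = 0 by apply/matrixP => -[i ni]; exfalso; rewrite n0 in ni.
  by rewrite enorm0 expr0n mulr0 /qform mulmx0 mxE.
have [mu mu_eig le_mu] := max_eigenvalue sQ n0.
apply: le_trans (le_mu x) _; rewrite ler_wpM2r ?sqr_ge0//.
apply: ub_le_sup mu_eig; exists mu => a; exact: eigenvalue_le.
Qed.

Lemma sigma_max_gt0 Q x : posdef Q -> x != 0 -> 0 < sigma_max Q.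
Proof.
move=> [sQ Q0] x0; rewrite -(pmulr_lgt0 _ (enorm_sqr_gt0 x0)).
by apply: lt_le_trans (qform_le_sigma_max x sQ); exact: Q0.
Qed.

Lemma sigma_max_ge0 Q : posdef Q -> 0 <= sigma_max Q.
Proof.
move=> pQ; have [n0|n0] := posnP n.
  (* In dimension zero there is no eigenvalue, and the supremum of the empty set
     is 0. *)
  rewrite /sigma_max (_ : [set a | _] = set0) ?sup0//.
  apply/seteqP; split => a //= /eigenvalueP[v _] /eqP[].
  by apply/matrixP => i [j nj]; exfalso; rewrite n0 in nj.
apply: ltW; apply: (@sigma_max_gt0 _ (const_mx 1)) => //.
apply/eqP => /matrixP /(_ (Ordinal n0) 0) /eqP.
by rewrite !mxE oner_eq0.
Qed.

End Rayleigh.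

(** * Trajectories and incremental stability *)

Lemma sum_shift (V : zmodType) (F : nat -> V) N :
  F 0%N + \sum_(k < N) F k.+1 = \sum_(k < N) F k + F N.
Proof.
elim: N => [|N IHN]; first by rewrite !big_ord0 addrC.
by rewrite big_ord_recr/= addrA IHN big_ord_recr.
Qed.

Section Trajectories.
Variables (R : realType) (n m : nat).
Variable f : 'cV[R]_n -> 'cV[R]_m -> 'cV[R]_n.
Implicit Types (x xb w : 'cV[R]_n) (u v : nat -> 'cV[R]_m).

Lemma eq_traj u v x k : (forall j, (j < k)%N -> u j = v j) ->
  traj f u x k = traj f v x k.
Proof.
elim: k => //= k IHk uv; rewrite uv// IHk// => j jk.
by apply: uv; exact: ltnW.
Qed.

Lemma traj_shift u x k :
  traj f (fun j => u j.+1) (f x (u 0%N)) k = traj f u x k.+1.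
Proof. by elim: k => //= k ->. Qed.

Lemma V_delta_impl_diag M x u : V_delta_impl M f x x u = 0.
Proof. by apply: big1 => k _; rewrite subrr enorm0 expr0n. Qed.

(** Only finitely many inputs enter a finite trajectory, so they may be
    continued by an arbitrary admissible input. *)
Lemma incr_exp_stable_inputs (U : set 'cV[R]_m) (C rho : R) L u x xb k :
  incr_exp_stable f U C rho -> U 0 -> inputs_in U L u -> (k <= L)%N ->
  enorm (traj f u x k - traj f u xb k) ^+ 2
    <= C * rho ^+ k * enorm (x - xb) ^+ 2.
Proof.
move=> ies U0 uU kL; pose v j := if (j < L)%N then u j else 0.
have uv j : (j < k)%N -> u j = v j.
  by move=> jk; rewrite /v (leq_trans jk kL).
rewrite !(eq_traj _ uv); apply: ies => j.
by rewrite /v; case: ifP => // /uU.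
Qed.

Lemma V_delta_impl_lower M x xb u : (0 < M)%N ->
  enorm (x - xb) ^+ 2 <= V_delta_impl M f x xb u.
Proof.
move=> hM; rewrite /V_delta_impl (bigD1 (Ordinal hM))//= lerDl sumr_ge0// => k _.
exact: sqr_ge0.
Qed.

Lemma V_delta_impl_upper (U : set 'cV[R]_m) (C rho : R) M x xb u :
  1 <= C -> 0 <= rho < 1 -> incr_exp_stable f U C rho -> U 0 ->
  inputs_in U M u ->
  V_delta_impl M f x xb u <= C * M%:R * enorm (x - xb) ^+ 2.
Proof.
move=> hC hrho ies U0 uU; rewrite mulrAC mulr_natr.
apply: le_trans (_ : \sum_(k < M) C * enorm (x - xb) ^+ 2 <= _); last first.
  by rewrite sumr_const card_ord.
apply: ler_sum => k _.
apply: le_trans (incr_exp_stable_inputs _ _ ies U0 uU (ltnW (ltn_ord k))) _.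
rewrite mulrAC; apply: ler_piMr; first by rewrite mulr_ge0 ?sqr_ge0// (le_trans ler01).
by case/andP: hrho => r0 /ltW r1; rewrite exprn_ile1.
Qed.

(** With [g = 1 - C rho^M > 0], shifting the window by one step drops the
    summand [|x - xb|^2] and adds one that is at most [C rho^M |x - xb|^2].
    Young's inequality with weight [eta = g / (2 C M)] separates the
    disturbance at the price of half of the gap [g]. *)
Lemma exists_impl_inequalities (U : set 'cV[R]_m) (C rho : R) M :
  1 <= C -> 0 <= rho < 1 -> incr_exp_stable f U C rho -> U 0 -> (0 < M)%N ->
  C * rho ^+ M < 1 ->
  exists c1 c2 c3 c4 : R,
    [/\ 0 < c1, 0 < c2, 0 < c3, 0 < c4 & impl_inequalities M f U c1 c2 c3 c4].
Proof.
move=> hC hrho ies U0 hM hCM; pose c2 := C * M%:R; pose g := 1 - C * rho ^+ M.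
have c2_gt0 : 0 < c2 by rewrite mulr_gt0 ?ltr0n//; lra.
have g_gt0 : 0 < g by rewrite subr_gt0.
pose eta := g / (2 * c2).
have eta_gt0 : 0 < eta by rewrite divr_gt0// mulr_gt0.
have etaV_gt0 : 0 < eta^-1 by rewrite invr_gt0.
exists 1, c2, (g / 2), ((1 + eta^-1) * c2).
split => //; [exact: divr_gt0|by rewrite mulr_gt0// addr_gt0|].
move=> x xb w u uU.
have uUM : inputs_in U M u by move=> k kM; apply: uU; exact: ltnW.
have vUM : inputs_in U M (fun k => u k.+1) by move=> k kM; exact: uU.
have upper x' xb' v := V_delta_impl_upper x' xb' (M := M) (u := v) hC hrho ies U0.
split; [by rewrite mul1r V_delta_impl_lower|exact: upper|].
set x1 := f x (u 0%N); set xb1 := f xb (u 0%N); set v := fun k => u k.+1 in vUM *.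
set D := enorm (x - xb) ^+ 2; set V := V_delta_impl M f x xb u.
have Vv : V_delta_impl M f x1 xb1 v <= V - g * D.
  have -> : V_delta_impl M f x1 xb1 v =
      V - D + enorm (traj f u x M - traj f u xb M) ^+ 2.
    apply/eqP; rewrite -addrA [- D + _]addrC addrA eq_sym subr_eq; apply/eqP.
    rewrite /V /V_delta_impl.
    under [in RHS]eq_bigr do rewrite /v /x1 /xb1 !traj_shift.
    have := sum_shift (fun k => enorm (traj f u x k - traj f u xb k) ^+ 2) M.
    by rewrite /= => <-; rewrite addrC.
  have := incr_exp_stable_inputs x xb ies U0 uU (leqnSn M).
  by rewrite -/D /g => h; lra.
have Vw : V_delta_impl M f (x1 + w) xb1 v <=
    (1 + eta) * V_delta_impl M f x1 xb1 v
    + (1 + eta^-1) * V_delta_impl M f (x1 + w) x1 v.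
  rewrite !mulr_sumr -big_split/=; apply: ler_sum => k _.
  have -> : traj f v (x1 + w) k - traj f v xb1 k =
      (traj f v x1 k - traj f v xb1 k) + (traj f v (x1 + w) k - traj f v x1 k).
    by rewrite [RHS]addrC addrA subrK.
  exact: enorm_young.
have := upper (x1 + w) x1 v vUM.
rewrite [_ - x1]addrAC subrr add0r -/c2 => Ww.
have VD : V <= c2 * D := upper x xb u uUM.
have e2 : eta * c2 = g / 2 by rewrite /eta; field; rewrite gt_eqF.
have D0 : 0 <= D := sqr_ge0 _.
apply: (le_trans Vw).
have h1 := ler_wpM2l (ltW (addr_gt0 ltr01 eta_gt0)) Vv.
have h2 := ler_wpM2l (ltW (addr_gt0 ltr01 etaV_gt0)) Ww.
have h3 := ler_wpM2l (ltW eta_gt0) VD.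
rewrite mulrA e2 in h3.
have h4 : 0 <= eta * g * D by rewrite mulr_ge0// mulr_ge0// ltW.
by lra.
Qed.

End Trajectories.

(** * The optimal value of the relaxed problem *)

Section RelaxedMPC.
Variables (R : realType) (n m N M : nat).
Variables (f : 'cV[R]_n -> 'cV[R]_m -> 'cV[R]_n).
Variables (l : 'cV[R]_n -> 'cV[R]_m -> R) (Vf : 'cV[R]_n -> R).
Variables (U : set 'cV[R]_m) (X Xf : set 'cV[R]_n).
Variables (kf : 'cV[R]_n -> 'cV[R]_m) (alphaf : R -> R).
Hypothesis hT : terminal_conditions N f l Vf U X Xf kf alphaf.
Hypothesis hXfX : Xf `<=` X.
Implicit Types (x xb w : 'cV[R]_n) (u e : nat -> 'cV[R]_m).

Local Notation feasible := (mpc_feasible N f U X Xf).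
Local Notation ext := (ext_input N f kf).
Local Notation shift u := (fun k : nat => u k.+1).

Lemma traj_ext xb u k : (k <= N)%N ->
  traj f (ext xb u) xb k = traj f u xb k.
Proof.
by move=> kN; apply: eq_traj => j jk; rewrite /ext_input (leq_trans jk kN).
Qed.

(** The feedback form of the extension determines it, since the input at time
    [k] only depends on the earlier ones. *)
Lemma ext_input_unique xb u e :
  (forall k, e k = if (k < N)%N then u k else kf (traj f e xb k)) ->
  forall k, ext xb u k = e k.
Proof.
move=> eE; elim/ltn_ind => k IHk; rewrite ext_inputE eE; case: ifP => // _.
by congr kf; exact: eq_traj.
Qed.

Lemma ext_shift xb u k : (0 < N)%N ->
  ext (f xb (u 0%N)) (shift (ext xb u)) k = ext xb u k.+1.
Proof.
move=> hN; apply: (ext_input_unique (e := shift (ext xb u))) => {}k; case: ltnP => // Nk.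
have -> : f xb (u 0%N) = f xb (ext xb u 0%N) by rewrite /ext_input hN.
by rewrite traj_shift [LHS]ext_inputE ltnNge (leq_trans Nk).
Qed.

Lemma ext_terminal xb u k : feasible xb u -> Xf (traj f (ext xb u) xb (N + k)).
Proof.
move=> [_ _ xN]; elim: k => [|k IHk]; first by rewrite addn0 traj_ext.
rewrite addnS /= [ext _ _ _]ext_inputE ltnNge leq_addr /=.
exact: (term_inv hT).
Qed.

Lemma ext_input_in xb u k : feasible xb u -> U (ext xb u k).
Proof.
move=> feas; case: (ltnP k N) => kN.
  by rewrite /ext_input kN; case: feas => uU _ _; exact: uU.
rewrite ext_inputE ltnNge kN /= -(subnKC kN).
by have [] := term_constr hT (ext_terminal (k - N) feas).
Qed.

Lemma feasible_shift xb u : (0 < N)%N -> feasible xb u ->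
  feasible (f xb (u 0%N)) (shift (ext xb u)).
Proof.
move=> hN feas.
have -> : f xb (u 0%N) = f xb (ext xb u 0%N) by rewrite /ext_input hN.
split; first by move=> k _; exact: ext_input_in.
- move=> k kN; rewrite traj_shift; case: (ltnP k.+1 N) => [kN1|Nk].
    by rewrite traj_ext 1?ltnW//; case: feas => _ + _; apply.
  by rewrite -(subnKC Nk); apply/hXfX/ext_terminal.
- by rewrite traj_shift -addn1; exact: ext_terminal.
Qed.

(** The terminal cost decreases along the terminal controller at least by the
    stage cost, which is what the additional stage of the extended plan costs. *)
Lemma mpc_cost_shift xb u : (0 < N)%N -> feasible xb u ->
  mpc_cost N f l Vf (f xb (u 0%N)) (shift (ext xb u))
    <= mpc_cost N f l Vf xb u - l xb (u 0%N).
Proof.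
move=> hN feas; set e := ext xb u.
have e0 : u 0%N = e 0%N by rewrite /e /ext_input hN.
have -> : mpc_cost N f l Vf xb u = mpc_cost N f l Vf xb e.
  rewrite /mpc_cost (traj_ext _ _ (leqnn N)); congr (_ + _).
  apply: eq_bigr => k _; rewrite traj_ext; last exact: ltnW.
  by rewrite /e /ext_input ltn_ord.
have eN : e N = kf (traj f e xb N) by rewrite /e {1}ext_inputE ltnn.
have := ext_terminal 0 feas; rewrite addn0 -/e => /(term_decrease hT).
have := sum_shift (fun k => l (traj f e xb k) (e k)) N.
rewrite e0 /mpc_cost; under [in X in _ -> _ -> X <= _]eq_bigr do rewrite traj_shift.
rewrite traj_shift /= eN; lra.
Qed.

Section Value.
Variables (lam c1 c2 c3 c4 : R).
Hypothesis hl0 : forall x (v : 'cV[R]_m), U v -> 0 <= l x v.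
Hypothesis hVf0 : forall x, 0 <= Vf x.
Hypothesis hN : (0 < N)%N.
Hypothesis lam_gt0 : 0 < lam.
Hypothesis hI : impl_inequalities M f U c1 c2 c3 c4.
Variables (xbar : 'cV[R]_n -> 'cV[R]_n) (ustar : 'cV[R]_n -> nat -> 'cV[R]_m).
Hypothesis hmin : forall x,
  impl_minimizer N M f l Vf kf U X Xf lam x (xbar x) (ustar x).

Definition impl_value x := impl_cost N M f l Vf kf lam x (xbar x) (ustar x).

Lemma minimizer_in x : U (ustar x 0%N) /\ X (xbar x).
Proof. by have [[uU xX _] _] := hmin x; split; [exact: uU|exact: (xX 0%N)]. Qed.

Lemma mpc_cost_lower xb u : feasible xb u -> l xb (u 0%N) <= mpc_cost N f l Vf xb u.
Proof.
move=> [uU _ _]; rewrite /mpc_cost (bigD1 (Ordinal hN))//= -addrA lerDl.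
by rewrite addr_ge0// sumr_ge0// => k _; exact/hl0/uU.
Qed.

Lemma impl_value_upper x xb u : feasible xb u ->
  impl_value x <= mpc_cost N f l Vf xb u + lam * (c2 * enorm (x - xb) ^+ 2).
Proof.
move=> feas; have [_ /(_ _ _ feas) /le_trans] := hmin x; apply.
rewrite lerD2l ler_pM2l//.
by have [] := @hI x xb 0 (ext xb u) (fun k _ => ext_input_in k feas).
Qed.

Lemma impl_value_lower x :
  l (xbar x) (ustar x 0%N) + lam * (c1 * enorm (x - xbar x) ^+ 2) <= impl_value x.
Proof.
have [feas _] := hmin x; rewrite lerD ?mpc_cost_lower// ler_pM2l//.
by have [] := @hI x (xbar x) 0 (ext (xbar x) (ustar x))
  (fun k _ => ext_input_in k feas).
Qed.

(** The shifted plan, started at the successor of the relaxed initial state, is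
    a candidate at the successor state; its inputs keep the two trajectories of
    the penalty coupled. *)
Lemma impl_value_step x w :
  impl_value (f x (ustar x 0%N) + w) <=
    impl_value x
    - (l (xbar x) (ustar x 0%N) + lam * (c3 * enorm (x - xbar x) ^+ 2))
    + lam * (c4 * enorm w ^+ 2).
Proof.
have [feas _] := hmin x; set xb := xbar x in feas *; set u := ustar x in feas *.
have [_ /(_ _ _ (feasible_shift hN feas)) /le_trans] :=
  hmin (f x (u 0%N) + w); apply.
have [_ _] := @hI x xb w (ext xb u) (fun k _ => ext_input_in k feas).
have -> : ext xb u 0%N = u 0%N by rewrite /ext_input hN.
rewrite -(ler_pM2l lam_gt0) /impl_cost.
have -> : ext (f xb (u 0%N)) (shift (ext xb u)) = shift (ext xb u).
  by apply/funext => k; exact: ext_shift.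
have := mpc_cost_shift hN feas.
rewrite /impl_value /impl_cost -/xb -/u; lra.
Qed.

End Value.
End RelaxedMPC.

(** * Quadratic Lyapunov functions and input-to-state stability *)

Lemma dissipation_sum (R : realDomainType) (V s r : nat -> R) T :
  (forall k, V k.+1 <= V k - s k + r k) ->
  V T + \sum_(k < T) s k <= V 0%N + \sum_(k < T) r k.
Proof.
move=> step; elim: T => [|T IHT]; first by rewrite !big_ord0.
by rewrite !big_ord_recr/=; have := step T; lra.
Qed.

Lemma class_K_linear (R : realType) (c : R) : 0 < c -> class_K (fun r => c * r).
Proof.
move=> c0; split; last by rewrite mulr0.
- apply: continuous_subspaceT => r; apply: continuousM; last exact: cvg_id.
  exact: cst_continuous.
- by move=> r s _ rs; rewrite ltr_pM2l.
Qed.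

Lemma class_KL_geometric (R : realType) (c s : R) : 0 < c -> 0 < s -> s < 1 ->
  class_KL (fun r k => c * s ^+ k * r).
Proof.
move=> c0 s0 s1; split=> [k|r r0].
  by apply: class_K_linear; rewrite mulr_gt0// exprn_gt0.
split; last first.
  have -> : (fun k => c * s ^+ k * r) = geometric (c * r) s.
    by apply/funext => k; rewrite /geometric/= mulrAC.
  by apply: cvg_geometric; rewrite gtr0_norm.
apply/nonincreasing_seqP => k; rewrite ler_wpM2r// ler_pM2l// exprS.
by rewrite ler_piMl ?exprn_ge0 1?ltW.
Qed.

Section QuadraticLyapunov.
Variables (R : realType) (n : nat).
Implicit Types x y w : 'cV[R]_n.

(** Along a trajectory the function contracts by the factor
    [th = a2 / (a2 + a3)] up to the disturbance term, whence a geometric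
    series in [th].  Using [a2 + a3] in place of [a2] in the contraction factor
    keeps [0 < th < 1]. *)
Lemma ISS_quadratic_lyapunov (fcl : 'cV[R]_n -> 'cV[R]_n -> 'cV[R]_n)
    (V : 'cV[R]_n -> R) (a1 a2 a3 a4 : R) :
  0 < a1 -> 0 < a2 -> 0 < a3 -> 0 < a4 ->
  (forall x, a1 * enorm x ^+ 2 <= V x) ->
  (forall x, V x <= a2 * enorm x ^+ 2) ->
  (forall x w, V (fcl x w) <= V x - a3 * enorm x ^+ 2 + a4 * enorm w ^+ 2) ->
  ISS fcl.
Proof.
move=> a1_gt0 a2_gt0 a3_gt0 a4_gt0 V_lower V_upper V_step.
have a23 : 0 < a2 + a3 by rewrite addr_gt0.
pose th := a2 / (a2 + a3).
have th_gt0 : 0 < th by rewrite divr_gt0.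
have th_lt1 : th < 1 by rewrite ltr_pdivrMr// mul1r ltrDl.
have th1 : 0 < 1 - th by rewrite subr_gt0.
pose G := a4 / (1 - th); have G_gt0 : 0 < G by rewrite divr_gt0.
have GE : th * G + a4 = G by rewrite /G; field; rewrite gt_eqF.
have V_contract x w : V (fcl x w) <= th * V x + a4 * enorm w ^+ 2.
  apply: le_trans (V_step x w) _; rewrite lerD2r.
  have V0 : 0 <= V x.
    by apply: le_trans (V_lower x); rewrite mulr_ge0 ?sqr_ge0// ltW.
  have thE : (a2 + a3) * th = a2 by rewrite /th mulrC divfK ?gt_eqF.
  rewrite -(ler_pM2l a23) [leRHS]mulrA thE.
  have e0 : 0 <= a3 * (a3 * enorm x ^+ 2) by rewrite mulrA -expr2 -exprMn sqr_ge0.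
  have := ler_wpM2l (ltW a3_gt0) (V_upper x); lra.
exists (fun r k => Num.sqrt (a2 / a1) * Num.sqrt th ^+ k * r),
  (fun r => Num.sqrt (G / a1) * r); split.
- apply: class_KL_geometric; rewrite ?sqrtr_gt0 ?divr_gt0//.
  by rewrite -sqrtr1 ltr_sqrt.
- by apply: class_K_linear; rewrite sqrtr_gt0 divr_gt0.
move=> x w dyn k; set W := \big[Num.max/0]_(j < k) _.
have V_iter : V (x k) <= th ^+ k * V (x 0%N) + G * W ^+ 2.
  rewrite /W; elim: k {W} => [|k IHk].
    by rewrite expr0 mul1r big_ord0 expr0n mulr0 addr0.
  rewrite dyn; apply: (le_trans (V_contract _ _)).
  apply: le_trans (_ : th * (th ^+ k * V (x 0%N)
    + G * (\big[Num.max/0]_(j < k) enorm (w j)) ^+ 2) + a4 * enorm (w k) ^+ 2 <= _).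
    by rewrite lerD2r ler_pM2l.
  set W := \big[Num.max/0]_(j < k) _; set W' := \big[Num.max/0]_(j < k.+1) _.
  have W0 : 0 <= W by exact: bigmax_ge_id.
  have WW' : W <= W' by exact: (le_bigmax_ord xpredT (fun j => enorm (w j))).
  have wW' : enorm (w k) <= W'.
    exact: (le_bigmax _ (fun j : 'I_k.+1 => enorm (w j)) ord_max).
  rewrite mulrDr mulrA -exprS -addrA lerD2l -[in leRHS]GE mulrDl mulrA.
  have W'0 := le_trans W0 WW'.
  apply: lerD; first by rewrite (ler_pM2l (mulr_gt0 th_gt0 G_gt0)) ler_pXn2r.
  by rewrite (ler_pM2l a4_gt0) ler_pXn2r ?nnegrE// enorm_ge0.
have W0 : 0 <= W by exact: bigmax_ge_id.
set p := _ * enorm (x 0%N); set q := _ * W.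
have p0 : 0 <= p by rewrite !mulr_ge0 ?exprn_ge0 ?sqrtr_ge0 ?enorm_ge0.
have q0 : 0 <= q by rewrite !mulr_ge0 ?sqrtr_ge0.
rewrite -(ler_pXn2r (isT : (0 < 2)%N)) ?nnegrE ?enorm_ge0 ?addr_ge0//.
apply: le_trans (_ : p ^+ 2 + q ^+ 2 <= _); last first.
  have := mulr_ge0 p0 q0; lra.
have a21 : 0 <= a2 / a1 by rewrite ltW// divr_gt0.
have Ga1 : 0 <= G / a1 by rewrite ltW// divr_gt0.
rewrite /p /q !exprMn exprAC (sqr_sqrtr a21) (sqr_sqrtr Ga1).
rewrite (sqr_sqrtr (ltW th_gt0)).
rewrite -(ler_pM2l a1_gt0); apply: (le_trans (V_lower _)); apply: (le_trans V_iter).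
have -> : a1 * (a2 / a1 * th ^+ k * enorm (x 0%N) ^+ 2 + G / a1 * W ^+ 2) =
    th ^+ k * (a2 * enorm (x 0%N) ^+ 2) + G * W ^+ 2.
  by field; rewrite gt_eqF.
by rewrite lerD2r ler_pM2l ?exprn_gt0.
Qed.

Lemma enorm_sqr_split (a b : R) x y : 0 < a -> 0 < b ->
  Num.min a b / 2 * enorm x ^+ 2 <= a * enorm y ^+ 2 + b * enorm (x - y) ^+ 2.
Proof.
move=> a0 b0; have := enorm_young y (x - y) (@ltr01 R).
rewrite addrC subrK invr1 => h; set c := Num.min a b.
have c0 : 0 < c by rewrite /c lt_min a0.
have ca : c <= a by rewrite /c ge_min lexx.
have cb : c <= b by rewrite /c ge_min lexx orbT.
have h1 := ler_wpM2r (sqr_ge0 (enorm y)) ca.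
have h2 := ler_wpM2r (sqr_ge0 (enorm (x - y))) cb.
have h3 := ler_wpM2l (ltW c0) h.
lra.
Qed.

End QuadraticLyapunov.

(** * Distances and compact reachable sets *)

Section Distance.
Variables (R : realType) (n : nat) (A : set 'cV[R]_n).
Implicit Types x s : 'cV[R]_n.

Lemma dist_set_le x s : A s -> dist_set A x <= enorm (x - s).
Proof.
move=> As; apply: ge_inf; last by exists s.
by exists 0 => _ [t _ <-]; exact: enorm_ge0.
Qed.

Lemma dist_set_ge0 x : 0 <= dist_set A x.
Proof.
have [->|/set0P[s As]] := eqVneq A set0; first by rewrite /dist_set image_set0 inf0.
apply: lb_le_inf; first by exists (enorm (x - s)), s.
by move=> _ [t _ <-]; exact: enorm_ge0.
Qed.

Lemma dist_set_sqr_le x s : A s -> dist_set A x ^+ 2 <= enorm (x - s) ^+ 2.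
Proof.
by move=> As; rewrite ler_pXn2r ?nnegrE ?dist_set_ge0 ?enorm_ge0// dist_set_le.
Qed.

(** The infimum need not be attained, so the bound is passed to it after
    taking square roots. *)
Lemma le_dist_set_sqr (a Y : R) x : 0 < a -> A !=set0 ->
  (forall s, A s -> Y <= a * enorm (x - s) ^+ 2) -> Y <= a * dist_set A x ^+ 2.
Proof.
move=> a0 [s0 As0] le_Y; rewrite mulrC -ler_pdivrMr//.
have le_sqrt : Num.sqrt (Y / a) <= dist_set A x.
  apply: lb_le_inf; first by exists (enorm (x - s0)), s0.
  move=> _ [s /le_Y ? <-].
  rewrite -[leRHS](ger0_norm (enorm_ge0 _)) -sqrtr_sqr ler_wsqrtr//.
  by rewrite ler_pdivrMr// mulrC.
have [Y0|/ltW Y0] := lerP 0 (Y / a); last exact: le_trans Y0 (sqr_ge0 _).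
rewrite -(sqr_sqrtr Y0) ler_pXn2r ?nnegrE ?sqrtr_ge0//.
exact: dist_set_ge0.
Qed.

End Distance.

Lemma compact_bounded_above (R : realType) (T : topologicalType) (g : T -> R)
    (A : set T) :
  {within A, continuous g} -> compact A -> exists B, forall t, A t -> g t <= B.
Proof.
move=> gA cA; have [->|/set0P A0] := eqVneq A set0; first by exists 0.
have [c _ gc] := compact_EVT_max A0 cA gA.
by exists (g c) => t At; apply: gc; rewrite inE.
Qed.

Section UniformCostBound.
Variables (R : realType) (n m : nat).
Variables (f : 'cV[R]_n -> 'cV[R]_m -> 'cV[R]_n) (l : 'cV[R]_n -> 'cV[R]_m -> R).
Variables (Vf : 'cV[R]_n -> R) (U : set 'cV[R]_m) (K : set 'cV[R]_n).
Hypothesis f_cont : {within [set p : 'cV[R]_n * 'cV[R]_m | U p.2],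
  continuous (fun p => f p.1 p.2)}.
Hypothesis l_cont : {within [set p : 'cV[R]_n * 'cV[R]_m | U p.2],
  continuous (fun p => l p.1 p.2)}.
Hypotheses (Vf_cont : continuous Vf) (U_compact : compact U) (K_compact : compact K).

(** One step maps [Kk] to the image of the compact set [Kk * U]; the dynamics are
    continuous on it because all its inputs are admissible. *)
Lemma compact_reachable k : exists2 Kk : set 'cV[R]_n, compact Kk &
  forall x u, K x -> inputs_in U k u -> Kk (traj f u x k).
Proof.
elim: k => [|k [Kk cKk reach]]; first by exists K.
exists ((fun p : 'cV[R]_n * 'cV[R]_m => f p.1 p.2) @` (Kk `*` U)).
  apply: continuous_compact; last exact: compact_setX.
  by apply: continuous_subspaceW f_cont => p [].
move=> x u Kx uU; exists (traj f u x k, u k) => //; split; last exact: uU.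
by apply: reach => // j jk; apply: uU; exact: ltnW.
Qed.

Lemma mpc_cost_bounded N : exists B, forall x u, K x -> inputs_in U N u ->
  mpc_cost N f l Vf x u <= B.
Proof.
have [B1 stage] : exists B, forall x u, K x -> inputs_in U N u ->
    \sum_(k < N) l (traj f u x k) (u k) <= B.
  elim: N => [|N [B stage]]; first by exists 0 => x u _ _; rewrite big_ord0.
  have [KN cKN reach] := compact_reachable N.
  have [B' lB'] : exists B', forall p : 'cV[R]_n * 'cV[R]_m,
      (KN `*` U) p -> l p.1 p.2 <= B'.
    apply: compact_bounded_above; last exact: compact_setX.
    by apply: continuous_subspaceW l_cont => p [].
  exists (B + B') => x u Kx uU; rewrite big_ord_recr/=.
  have uUN : inputs_in U N u by move=> j jN; apply: uU; exact: ltnW.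
  apply: lerD; first exact: stage.
  by apply: (lB' (traj f u x N, u N)); split; [exact: reach|exact: uU].
have [KN cKN reach] := compact_reachable N.
have [B2 terminal] := compact_bounded_above (continuous_subspaceT Vf_cont) cKN.
exists (B1 + B2) => x u Kx uU; apply: lerD; first exact: stage.
by apply: terminal; exact: reach.
Qed.

End UniformCostBound.

(** * Performance of the closed loop *)

(** The terminal feedback, used from the start, is an extension of the empty
    input sequence.  Its stage costs are paid for by the decrease of the terminal
    cost. *)
Lemma terminal_feasible (R : realType) (n m N : nat)
    (f : 'cV[R]_n -> 'cV[R]_m -> 'cV[R]_n) (l : 'cV[R]_n -> 'cV[R]_m -> R)
    (Vf : 'cV[R]_n -> R) (U : set 'cV[R]_m) (X Xf : set 'cV[R]_n)
    (kf : 'cV[R]_n -> 'cV[R]_m) (alphaf : R -> R) (x : 'cV[R]_n) :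
  terminal_conditions N f l Vf U X Xf kf alphaf -> Xf `<=` X -> Xf x ->
  exists2 u, mpc_feasible N f U X Xf x u & mpc_cost N f l Vf x u <= Vf x.
Proof.
move=> hT hXfX Xfx; pose u := ext_input 0 f kf x (fun=> 0).
have uE k : u k = kf (traj f u x k) by rewrite {1}/u ext_inputE.
have xXf k : Xf (traj f u x k).
  by elim: k => //= k IHk; rewrite uE; exact: (term_inv hT).
exists u.
  split=> [k _|k _|//]; last exact: hXfX.
  by rewrite uE; have [] := term_constr hT (xXf k).
rewrite /mpc_cost addrC.
apply: le_trans (dissipation_sum (V := fun k => Vf (traj f u x k))
  (s := fun k => l (traj f u x k) (u k)) (r := fun=> 0) N _) _ => [k|].
  by rewrite addr0 /= uE; exact: (term_decrease hT).
by rewrite big1// addr0.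
Qed.

(** With [eps = sigma_max Q / (lam c3)], Young's inequality bounds [|x|_Q^2] by
    [(1 + eps) (|xb|_Q^2 + |x - xb|_Q^2 / eps)], and
    [|x - xb|_Q^2 / eps <= lam c3 |x - xb|^2]. *)
Lemma qform_relaxation (R : realType) (n : nat) (Q : 'M[R]_n) (lam c3 : R)
    (x xb : 'cV[R]_n) : posdef Q -> 0 < lam -> 0 < c3 ->
  qform Q x <= (1 + lam^-1 * (sigma_max Q / c3))
               * (qform Q xb + lam * (c3 * enorm (x - xb) ^+ 2)).
Proof.
move=> pQ lam_gt0 c3_gt0; set s := sigma_max Q.
have s_ge0 : 0 <= s := sigma_max_ge0 pQ.
have [xxb|neq] := eqVneq x xb.
  rewrite xxb subrr enorm0 expr0n !mulr0 addr0 ler_peMl ?qform_ge0//.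
  by rewrite lerDl mulr_ge0 ?divr_ge0 ?invr_ge0 ?(ltW lam_gt0) ?(ltW c3_gt0).
have s_gt0 : 0 < s by apply: (sigma_max_gt0 (x := x - xb)); rewrite ?subr_eq0.
set e := lam^-1 * (s / c3); have e_gt0 : 0 < e by rewrite mulr_gt0 ?divr_gt0 ?invr_gt0.
have := qform_young xb (x - xb) (fun z => qform_ge0 z pQ) e_gt0.
rewrite [xb + _]addrC subrK => /le_trans; apply.
rewrite mulrDr lerD2l.
have -> : 1 + e^-1 = (1 + e) / e by field; rewrite gt_eqF.
rewrite -mulrA ler_pM2l ?addr_gt0// ler_pdivrMl//.
have -> : e * (lam * (c3 * enorm (x - xb) ^+ 2)) = s * enorm (x - xb) ^+ 2.
  by rewrite /e; field; rewrite !gt_eqF.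
exact: qform_le_sigma_max pQ.1.
Qed.

Section ClosedLoop.
Variables (R : realType) (n m N M : nat).
Variables (f : 'cV[R]_n -> 'cV[R]_m -> 'cV[R]_n) (l : 'cV[R]_n -> 'cV[R]_m -> R).
Variables (U : set 'cV[R]_m) (X Xf : set 'cV[R]_n).
Variables (Vf : 'cV[R]_n -> R) (kf : 'cV[R]_n -> 'cV[R]_m).
Variables (alphal alphaf : R -> R) (cl cf : R) (Q : 'M[R]_n) (Ru : 'M[R]_m).
Hypothesis hN : (1 <= N)%N.
Hypothesis hl0 : forall x u, U u -> 0 <= l x u.
Hypotheses (hVf : continuous Vf) (hVf0 : forall x, 0 <= Vf x).
Hypothesis hXfX : Xf `<=` X.
Hypothesis hR : regularity f l U X alphal.
Hypothesis hT : terminal_conditions N f l Vf U X Xf kf alphaf.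
Hypothesis hE : simplifying_conditions l U alphal alphaf cl cf Q Ru.
Variables (c1 c2 c3 c4 : R).
Hypotheses (c1_gt0 : 0 < c1) (c2_gt0 : 0 < c2) (c3_gt0 : 0 < c3) (c4_gt0 : 0 < c4).
Hypothesis hI : impl_inequalities M f U c1 c2 c3 c4.

Local Notation feasible := (mpc_feasible N f U X Xf).
Local Notation XN := (feasible_set N f U X Xf).

Lemma stage_coef_gt0 : 0 < cl.
Proof.
have [[_ al_incr al0] _] := reg_alphal hR.
have := al_incr 0 1 (lexx _) ltr01; rewrite al0.
by rewrite (simp_alphal hE ler01) expr1n mulr1.
Qed.

Lemma stage_cost_lower x u : U u -> cl * enorm x ^+ 2 <= l x u.
Proof.
move=> Uu; apply: le_trans (reg_lower hR x Uu).
have xu := addr_ge0 (enorm_ge0 x) (enorm_ge0 u).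
rewrite (simp_alphal hE xu) ler_pM2l ?stage_coef_gt0//.
by rewrite ler_pXn2r ?nnegrE ?enorm_ge0// lerDl enorm_ge0.
Qed.

Lemma origin_feasible : exists2 u, feasible 0 u & mpc_cost N f l Vf 0 u <= 0.
Proof.
have Xf0 : Xf 0 by apply: interior_subset; exact: term_Xf0 hT.
have [u feas cost_u] := terminal_feasible hT hXfX Xf0; exists u => //.
apply: le_trans cost_u _; apply: le_trans (term_upper hT Xf0) _.
by rewrite enorm0; have [[_ _ ->] _] := term_alphaf hT.
Qed.

Lemma feasible_set_cost_bound : exists2 B, 0 <= B &
  forall x, XN x -> exists2 u, feasible x u & mpc_cost N f l Vf x u <= B.
Proof.
have [B cost_le] :=
  mpc_cost_bounded (reg_f hR) (reg_l hR) hVf (reg_U hR) (term_XN hT) N.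
exists (Num.max 0 B) => [|x XNx]; first by rewrite le_max lexx.
have [u feas] := XNx; exists u => //.
by rewrite le_max cost_le ?orbT//; case: feas.
Qed.

Section FixedWeight.
Variable lam : R.
Hypothesis lam_gt0 : 0 < lam.
Variables (xbar : 'cV[R]_n -> 'cV[R]_n) (ustar : 'cV[R]_n -> nat -> 'cV[R]_m).
Hypothesis hmin : forall x,
  impl_minimizer N M f l Vf kf U X Xf lam x (xbar x) (ustar x).

Local Notation V := (impl_value N M f l Vf kf lam xbar ustar).
Local Notation fcl := (fun x w => f x (ustar x 0%N) + w).

(** From the relaxed initial state [0] some plan has no cost, so the value is
    bounded by the penalty alone, on the whole space.  The lower bound and the
    decrease are quadratic in the true state because [x = xb + (x - xb)]. *)
Lemma closed_loop_ISS : ISS fcl.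
Proof.
have cl_gt0 := stage_coef_gt0.
have lc a : 0 < a -> 0 < Num.min cl (lam * a) / 2.
  by move=> a0; rewrite divr_gt0// lt_min cl_gt0 mulr_gt0.
have split_le a x : 0 < a -> Num.min cl (lam * a) / 2 * enorm x ^+ 2 <=
    l (xbar x) (ustar x 0%N) + lam * (a * enorm (x - xbar x) ^+ 2).
  move=> a0; apply: le_trans (enorm_sqr_split x (xbar x) cl_gt0 (mulr_gt0 lam_gt0 a0)) _.
  rewrite [lam * (a * _)]mulrA lerD2r stage_cost_lower//.
  by have [] := minimizer_in hN hmin x.
apply: (ISS_quadratic_lyapunov (V := V) (lc _ c1_gt0) (mulr_gt0 lam_gt0 c2_gt0)
  (lc _ c3_gt0) (mulr_gt0 lam_gt0 c4_gt0)).
- move=> x; apply: le_trans (split_le _ _ c1_gt0) _.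
  exact: (impl_value_lower hT hl0 hVf0 hN lam_gt0 hI hmin).
- move=> x; have [u feas cost0] := origin_feasible.
  have := impl_value_upper hT lam_gt0 hI hmin x feas.
  by rewrite subr0 => /le_trans; apply; rewrite -mulrA gerDr.
- move=> x w; have := impl_value_step hT hXfX hN lam_gt0 hI hmin x w.
  move=> /le_trans; apply; rewrite [lam * (c4 * _)]mulrA lerD2r lerD2l lerN2.
  exact: split_le.
Qed.

Section Trajectory.
Variables (x w : nat -> 'cV[R]_n) (T : nat).
Hypothesis dyn : forall k, x k.+1 = fcl (x k) (w k).

Lemma impl_value_ge0 y : 0 <= V y.
Proof.
have [Uu _] := minimizer_in hN hmin y.
apply: le_trans (impl_value_lower hT hl0 hVf0 hN lam_gt0 hI hmin y).
apply: addr_ge0; first exact: hl0.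
by rewrite mulr_ge0 ?(ltW lam_gt0)// mulr_ge0 ?sqr_ge0// ltW.
Qed.

Lemma closed_loop_dissipation :
  \sum_(k < T) (l (xbar (x k)) (ustar (x k) 0%N)
                + lam * (c3 * enorm (x k - xbar (x k)) ^+ 2))
  <= V (x 0%N) + lam * (c4 * \sum_(k < T) enorm (w k) ^+ 2).
Proof.
have step k : V (x k.+1) <= V (x k)
    - (l (xbar (x k)) (ustar (x k) 0%N)
       + lam * (c3 * enorm (x k - xbar (x k)) ^+ 2))
    + lam * (c4 * enorm (w k) ^+ 2).
  by rewrite dyn; exact: (impl_value_step hT hXfX hN lam_gt0 hI hmin).
rewrite !mulr_sumr.
apply: le_trans (dissipation_sum (V := fun k => V (x k)) T step).
by rewrite lerDr impl_value_ge0.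
Qed.

(** The relaxed initial state satisfies the state constraint, so its distance
    to the true state bounds the violation.  Dividing the dissipation
    inequality by [lam c3] leaves the cost bound [B] with the factor [1 / lam],
    whereas the penalty and the disturbance terms lose their factor [lam]. *)
Lemma constraint_violation B :
  (forall s, XN s -> exists2 u, feasible s u & mpc_cost N f l Vf s u <= B) ->
  \sum_(k < T) dist_set X (x k) ^+ 2 <=
    c2 / c3 * dist_set XN (x 0%N) ^+ 2 + B / c3 / lam
    + c4 / c3 * \sum_(k < T) enorm (w k) ^+ 2.
Proof.
move=> costB; set W := \sum_(k < T) enorm (w k) ^+ 2.
set S := \sum_(k < T) _.
rewrite -addrA -lerBlDr; apply: le_dist_set_sqr; first by rewrite divr_gt0.
  by have [u feas _] := origin_feasible; exists 0, u.
move=> s XNs; have [u feas uB] := costB s XNs.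
have h1 : lam * (c3 * S) <=
    \sum_(k < T) (l (xbar (x k)) (ustar (x k) 0%N)
                + lam * (c3 * enorm (x k - xbar (x k)) ^+ 2)).
  rewrite /S !mulr_sumr; apply: ler_sum => k _.
  have [Uu Xxb] := minimizer_in hN hmin (x k).
  apply: ler_wpDl; first exact: hl0.
  by rewrite !ler_pM2l//; exact: dist_set_sqr_le.
have h2 := impl_value_upper hT lam_gt0 hI hmin (x 0%N) feas.
have h3 := closed_loop_dissipation.
rewrite -/W in h3.
rewrite -(ler_pM2l (mulr_gt0 lam_gt0 c3_gt0)).
have -> : lam * c3 * (S - (B / c3 / lam + c4 / c3 * W)) =
    lam * (c3 * S) - B - lam * (c4 * W).
  by field; rewrite !gt_eqF.
have -> : lam * c3 * (c2 / c3 * enorm (x 0%N - s) ^+ 2) =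
    lam * (c2 * enorm (x 0%N - s) ^+ 2).
  by field; rewrite gt_eqF.
move: uB h1 h2 h3; lra.
Qed.

(** Feasible plans from the true initial state carry no penalty, so the value
    there is at most the nominal one; the stage costs at [x] and at [xb] differ
    only in the state term, which [qform_relaxation] controls. *)
Lemma closed_loop_performance : XN (x 0%N) ->
  (1 + lam^-1 * (sigma_max Q / c3))^-1 * \sum_(k < T) l (x k) (ustar (x k) 0%N)
    <= V_nom N f l Vf U X Xf (x 0%N)
       + lam * c4 * \sum_(k < T) enorm (w k) ^+ 2.
Proof.
move=> [u0 feas0]; set eps := lam^-1 * _.
have eps_ge0 : 0 <= eps.
  rewrite /eps mulr_ge0 ?invr_ge0 ?(ltW lam_gt0)//.
  by rewrite divr_ge0 ?(ltW c3_gt0)//; exact: sigma_max_ge0 (simp_Q hE).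
have eps1_gt0 : 0 < 1 + eps by exact: ltr_wpDr.
have le_nom : V (x 0%N) <= V_nom N f l Vf U X Xf (x 0%N).
  apply: lb_le_inf; first by exists (mpc_cost N f l Vf (x 0%N) u0), u0.
  move=> _ [u feas <-].
  have := impl_value_upper hT lam_gt0 hI hmin (x 0%N) feas.
  by rewrite subrr enorm0 expr0n !mulr0 addr0.
rewrite -mulrA -(lerD2r (lam * (c4 * \sum_(k < T) enorm (w k) ^+ 2))) in le_nom *.
apply: le_trans le_nom; apply: le_trans closed_loop_dissipation.
rewrite ler_pdivrMl// mulr_sumr; apply: ler_sum => k _.
have [Uu _] := minimizer_in hN hmin (x k).
rewrite !(simp_l hE _ Uu) !(wnorm_sqrE _ (simp_Q hE)).
have := qform_relaxation (x k) (xbar (x k)) (simp_Q hE) lam_gt0 c3_gt0.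
rewrite -/eps; set r := wnorm _ _ ^+ 2.
(* The input cost [r] enters the right-hand side with the factor [1 + eps]. *)
have r0 : 0 <= eps * r.
  by rewrite mulr_ge0 ?sqr_ge0.
lra.
Qed.

End Trajectory.
End FixedWeight.
End ClosedLoop.

(** * Guarantees for all weights *)

Theorem theorem4 (R : realType) (n m N M : nat)
  (f : 'cV[R]_n -> 'cV[R]_m -> 'cV[R]_n) (l : 'cV[R]_n -> 'cV[R]_m -> R)
  (U : set 'cV[R]_m) (X Xf : set 'cV[R]_n)
  (Vf : 'cV[R]_n -> R) (kf : 'cV[R]_n -> 'cV[R]_m)
  (alphal alphaf : R -> R) (cl cf : R) (Q : 'M[R]_n) (Ru : 'M[R]_m)
  (C rho : R)
  (xbar_impl : R -> 'cV[R]_n -> 'cV[R]_n)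
  (u_impl : R -> 'cV[R]_n -> nat -> 'cV[R]_m)
  (hN : (1 <= N)%N)
  (hl0 : forall x u, U u -> 0 <= l x u)
  (hX : closed X)
  (hVf : continuous Vf) (hVf0 : forall x, 0 <= Vf x)
  (hXf : closed Xf) (hXfX : Xf `<=` X)
  (hR : regularity f l U X alphal)
  (hT : terminal_conditions N f l Vf U X Xf kf alphaf)
  (hE : simplifying_conditions l U alphal alphaf cl cf Q Ru)
  (hC : 1 <= C) (hrho : 0 <= rho < 1)
  (hIES : incr_exp_stable f U C rho)
  (hM : (1 <= M)%N) (hCM : C * rho ^+ M < 1)
  (hmin : forall lam : R, 0 < lam -> forall x : 'cV[R]_n,
     impl_minimizer N M f l Vf kf U X Xf lam x (xbar_impl lam x) (u_impl lam x)) :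
  let pi_impl (lam : R) (x : 'cV[R]_n) : 'cV[R]_m := u_impl lam x 0%N in
  let closed_loop (lam : R) (x w : 'cV[R]_n) : 'cV[R]_n :=
    f x (pi_impl lam x) + w in
  let XN : set 'cV[R]_n := feasible_set N f U X Xf in
  (exists cd1 cd2 cd3 cd4 : R,
    [/\ 0 < cd1, 0 < cd2, 0 < cd3, 0 < cd4 &
        impl_inequalities M f U cd1 cd2 cd3 cd4]) /\
  forall cd1 cd2 cd3 cd4 : R,
  0 < cd1 -> 0 < cd2 -> 0 < cd3 -> 0 < cd4 ->
  impl_inequalities M f U cd1 cd2 cd3 cd4 ->
  [/\ (forall lam : R, 0 < lam -> ISS (closed_loop lam)),
      (exists cX1 cX2 cX3 : R,
        [/\ 0 <= cX1, 0 <= cX2, 0 <= cX3 &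
          forall (lam : R) (x w : nat -> 'cV[R]_n) (T : nat),
            0 < lam ->
            (forall k, x k.+1 = closed_loop lam (x k) (w k)) ->
            \sum_(k < T) dist_set X (x k) ^+ 2
            <= cX1 * dist_set XN (x 0%N) ^+ 2 + cX2 / lam
               + cX3 * \sum_(k < T) enorm (w k) ^+ 2]) &
      (forall (lam : R) (x w : nat -> 'cV[R]_n) (T : nat),
         0 < lam ->
         (forall k, x k.+1 = closed_loop lam (x k) (w k)) ->
         XN (x 0%N) ->
         let eps := lam^-1 * (sigma_max Q / cd3) in
         (1 + eps)^-1 * \sum_(k < T) l (x k) (pi_impl lam (x k))
         <= V_nom N f l Vf U X Xf (x 0%N)
            + lam * cd4 * \sum_(k < T) enorm (w k) ^+ 2)].
Proof.
move=> pi_impl closed_loop XN; split.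
  have U0 : U 0 by apply: interior_subset; exact: reg_U0 hR.
  exact: exists_impl_inequalities hC hrho hIES U0 hM hCM.
move=> c1 c2 c3 c4 c1_gt0 c2_gt0 c3_gt0 c4_gt0 hI; split.
- move=> lam lam_gt0.
  exact: (closed_loop_ISS hN hl0 hVf0 hXfX hR hT hE c1_gt0 c2_gt0 c3_gt0 c4_gt0
    hI lam_gt0 (hmin _ lam_gt0)).
- have [B B_ge0 costB] := feasible_set_cost_bound hVf hR hT.
  exists (c2 / c3), (B / c3), (c4 / c3).
  split; [exact/ltW/divr_gt0|exact: divr_ge0 B_ge0 (ltW c3_gt0)
         |exact/ltW/divr_gt0|].
  move=> lam x w T lam_gt0 dyn.
  exact: (constraint_violation hN hl0 hVf0 hXfX hT c1_gt0 c2_gt0 c3_gt0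
    hI lam_gt0 (hmin _ lam_gt0) T dyn costB).
- move=> lam x w T lam_gt0 dyn XNx.
  exact: (closed_loop_performance hN hl0 hVf0 hXfX hT hE c1_gt0 c3_gt0
    hI lam_gt0 (hmin _ lam_gt0) T dyn XNx).
Qed.
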